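(* If $-1/2\leq\beta\leq0$, then, for every integer $n\geq0$, $$\Lambda_n^{(0,\beta)}=\lambda_n^{(0,\beta)}(1)=\ell_n^{(\beta)},$$ where $\ell_n^{(\beta)}=\int_{-1}^1\bigl|K_n^{(0,\beta)}(1,t)\bigr|(1+t)^\beta\,dt$.
   Context: $P_n^{(\alpha,\beta)}$ is the Jacobi polynomial of degree $n$ normalised by $P_n^{(\alpha,\beta)}(1)=(\alpha+1)_n/n!$. For $\beta>-1$ let $h_j^{(0,\beta)}=\int_{-1}^1 P_j^{(0,\beta)}(t)^2(1+t)^\beta\,dt$ and $$K_n^{(0,\beta)}(x,t)=\sum_{j=0}^n\frac{P_j^{(0,\beta)}(x)P_j^{(0,\beta)}(t)}{h_j^{(0,\beta)}},$$ $$\lambda_n^{(0,\beta)}(x)=\int_{-1}^1\bigl|K_n^{(0,\beta)}(x,t)\bigr|(1+t)^\beta\,dt,\qquad \Lambda_n^{(0,\beta)}=\sup_{-1\leq x\leq1}\lambda_n^{(0,\beta)}(x).$$ *)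

(* Defs.v *)
From mathcomp Require Import all_boot all_order all_algebra.
From mathcomp Require Import all_classical all_reals all_analysis.
Set Implicit Arguments.
Unset Strict Implicit.
Unset Printing Implicit Defensive.
Import Order.TTheory GRing.Theory Num.Theory.
Import numFieldNormedType.Exports.
Local Open Scope classical_set_scope.
Local Open Scope ring_scope.

(* (a)_k = a (a + 1) ... (a + k - 1) *)
Definition pochhammer (R : realType) (a : R) (k : nat) : R :=
  \prod_(i < k) (a + i%:R).

(* The coefficients of P_n^(a, b) at powers of (x - 1) / 2, as in Szego,
   Orthogonal Polynomials, (4.21.2).  Equivalently,
   P_n^(a, b)(x) = (a + 1)_n / n! 2F1(- n, n + a + b + 1; a + 1; (1 - x) / 2),
   without the division by (a + 1)_k. *)
Definition jacobi_coef (R : realType) (a b : R) (n k : nat) : R :=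
  pochhammer (n%:R + a + b + 1) k * pochhammer (a + k%:R + 1) (n - k)
  / (k`!%:R * (n - k)`!%:R).

Definition jacobi (R : realType) (a b : R) (n : nat) : {poly R} :=
  \sum_(k < n.+1) jacobi_coef a b n k *: (2^-1 *: ('X - 1%:P)) ^+ k.

Lemma jacobi_at1 (R : realType) (a b : R) (n : nat) :
  (jacobi a b n).[1] = pochhammer (a + 1) n / n`!%:R.
Proof.
rewrite /jacobi horner_sum big_ord_recl /= big1 ?addr0 => [|i _].
  rewrite expr0 hornerZ hornerC mulr1 /jacobi_coef subn0 addr0.
  by rewrite {1}/pochhammer big_ord0 !mul1r.
by rewrite !hornerE subrr mulr0 expr0n mulr0.
Qed.

(* For b != 0 the weight vanishes at t = -1, since 0 `^ b = 0 even when b < 0;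
   a single point does not contribute to the integrals. *)
Definition jacobi_weight (R : realType) (b t : R) : R := (1 + t) `^ b.

Definition jacobi_h (R : realType) (b : R) (j : nat) : R :=
  \int[@lebesgue_measure R]_(t in `[-1, 1])
    ((jacobi 0 b j).[t] ^+ 2 * jacobi_weight b t).

Definition jacobi_kernel (R : realType) (b : R) (n : nat) (x t : R) : R :=
  \sum_(j < n.+1) (jacobi 0 b j).[x] * (jacobi 0 b j).[t] / jacobi_h b j.

(* The Lebesgue function and constant are taken in \bar R, so that neither the
   integral nor the supremum relies on a default value. *)
Definition lebesgue_fun (R : realType) (b : R) (n : nat) (x : R) : \bar R :=
  (\int[@lebesgue_measure R]_(t in `[(-1)%R, 1%R])
    (`|jacobi_kernel b n x t| * jacobi_weight b t)%:E)%E.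

Definition lebesgue_cst (R : realType) (b : R) (n : nat) : \bar R :=
  ereal_sup [set lebesgue_fun b n x | x in `[-1, 1]].

Definition jacobi_ell (R : realType) (b : R) (n : nat) : \bar R :=
  (\int[@lebesgue_measure R]_(t in `[(-1)%R, 1%R])
    (`|jacobi_kernel b n 1 t| * jacobi_weight b t)%:E)%E.

(* Main.v *)
(* In the variables [X = (1 + x) / 2] and [T = (1 + t) / 2], the Jacobi
   polynomials satisfy a product formula: [P_n(X) P_n(T)] is the generalized
   translate by [X] of [P_n], evaluated at [T].  The translate of [T ^ m] is
   [\sum_p 'C(m, p) (b + 1)_m / (p! (b + 1)_(m - p)) A ^ (m - p) B ^ p], with
   [A = X T] and [B = (1 - X) (1 - T)]; it commutes with the Jacobi differential
   operator, whose polynomial eigenfunctions are determined by their value at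
   [1], and the product formula follows.  Hence, since [P_n(1) = 1], the kernel
   [K_n(x, t)] is the translate of [K_n(1, t)].

   For [-1/2 <= b <= 0] translation preserves positivity on [[0, 1]]: by
   Koornwinder's formula it is an average over two beta laws, here represented
   only by their moments, so that the degenerate cases [b = -1/2] and [b = 0] need
   no special treatment.  It also preserves the integral against the weight.
   Applied to a polynomial slightly above [`|K_n(1, t)|], these two facts bound
   the Lebesgue function at [x] by its value at [1]. *)
From HB Require Import structures.
Require Import Defs.
From mathcomp Require Import all_boot all_order all_algebra.
From mathcomp Require Import all_classical all_reals all_analysis.
From mathcomp Require Import measurable_realfun ring lra zify.
Set Implicit Arguments.
Unset Strict Implicit.
Unset Printing Implicit Defensive.
Import Order.TTheory GRing.Theory Num.Theory.
Import numFieldNormedType.Exports.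
Local Open Scope classical_set_scope.
Local Open Scope ring_scope.

(** * Linear maps prescribed on monomials *)

Section PolyLin.
Variables (R : comNzRingType) (V : lmodType R) (M : nat -> V).

(** Beta means and generalized translations are both extensions of this kind, so identities between
    them need only be checked on ['X^m]. *)
Definition poly_lin (p : {poly R}) : V := \sum_(i < size p) p`_i *: M i.

Lemma poly_linE (N : nat) (p : {poly R}) : (size p <= N)%N ->
  poly_lin p = \sum_(i < N) p`_i *: M i.
Proof.
move=> hN; rewrite /poly_lin (big_ord_widen N (fun i => p`_i *: M i)) //.
rewrite [RHS](bigID (fun i : 'I_N => (i < size p)%N)) /= [X in _ + X]big1 ?addr0 //.
by move=> i; rewrite -leqNgt => hi; rewrite nth_default // scale0r.
Qed.

Lemma poly_lin_is_linear : linear poly_lin.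
Proof.
move=> a p q; set N := maxn (size (a *: p + q)) (maxn (size p) (size q)).
rewrite !(@poly_linE N) ?leq_max ?leqnn ?orbT //.
rewrite scaler_sumr -big_split /=; apply: eq_bigr => i _.
by rewrite coefD coefZ scalerDl scalerA.
Qed.

HB.instance Definition _ :=
  GRing.isLinear.Build R {poly R} V *:%R poly_lin poly_lin_is_linear.

Lemma poly_linXn (m : nat) : poly_lin 'X^m = M m.
Proof.
rewrite (@poly_linE m.+1) ?size_polyXn // big_ord_recr /= coefXn eqxx scale1r.
rewrite big1 ?add0r // => i _; rewrite coefXn; case: eqP => [e|]; last by rewrite scale0r.
by have := ltn_ord i; rewrite e ltnn.
Qed.

End PolyLin.
Arguments poly_lin : simpl never.

Lemma poly_lin_comp (R : comNzRingType) (V W : lmodType R) (M : nat -> V)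
    (F : {linear V -> W}) (p : {poly R}) :
  F (poly_lin M p) = poly_lin (fun i => F (M i)) p.
Proof. by rewrite /poly_lin linear_sum; apply: eq_bigr => i _; rewrite linearZ. Qed.

(** * Pochhammer symbols and the Chu-Vandermonde sum *)

Section Pochhammer.
Variable R : realType.
Implicit Types a c : R.

Lemma pochhammer0 a : pochhammer a 0 = 1.
Proof. by rewrite /pochhammer big_ord0. Qed.

Lemma pochhammerS a k : pochhammer a k.+1 = pochhammer a k * (a + k%:R).
Proof. by rewrite /pochhammer big_ord_recr. Qed.

Lemma pochhammerSl a k : pochhammer a k.+1 = a * pochhammer (a + 1) k.
Proof.
rewrite /pochhammer big_ord_recl addr0; congr (_ * _).
by apply: eq_bigr => i _; rewrite lift0 -addrA (addrC 1) natr1.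
Qed.

Lemma pochhammerD a k l :
  pochhammer a (k + l) = pochhammer a k * pochhammer (a + k%:R) l.
Proof.
elim: l => [|l IH]; first by rewrite addn0 pochhammer0 mulr1.
by rewrite addnS !pochhammerS IH natrD addrA mulrA.
Qed.

Lemma pochhammer_gt0 a k : 0 < a -> 0 < pochhammer a k.
Proof. by move=> a0; apply: prodr_gt0 => i _; rewrite ltr_wpDr. Qed.

Lemma pochhammer_ge0 a k : 0 <= a -> 0 <= pochhammer a k.
Proof. by move=> a0; apply: prodr_ge0 => i _; rewrite addr_ge0. Qed.

Lemma pochhammer_neq0 a k : 0 < a -> pochhammer a k != 0.
Proof. by move=> a0; rewrite gt_eqF // pochhammer_gt0. Qed.

Lemma pochhammer_nat j k : pochhammer (j%:R + 1 : R) k * j`!%:R = (j + k)`!%:R.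
Proof.
elim: k => [|k IH]; first by rewrite pochhammer0 mul1r addn0.
rewrite pochhammerS mulrAC IH addnS factS natrM mulrC; congr (_ * _).
by rewrite -natr1 natrD addrAC.
Qed.

Lemma pochhammer1 k : pochhammer (1 : R) k = k`!%:R.
Proof. by have := pochhammer_nat 0 k; rewrite fact0 mulr1 add0r add0n. Qed.

Lemma pochhammer_half k :
  (4 ^ k)%:R * pochhammer (2^-1 : R) k * k`!%:R = (k.*2)`!%:R.
Proof.
elim: k => [|k IH]; first by rewrite pochhammer0 !mulr1.
rewrite pochhammerS doubleS !factS !natrM -IH expnS natrM.
have -> : k.*2.+2%:R = 2 * (k%:R + 1) :> R by rewrite -doubleS -mul2n natrM natr1.
have -> : k.*2.+1%:R = 2 * (k%:R) + 1 :> R by rewrite -natr1 -mul2n natrM.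
by rewrite -natr1; field.
Qed.

(** Induction on [p]. Pascal's rule splits the sum in two; term by term, [(c + k) + (q - k) = c + q]
    factors out and leaves the identity at [c + 1]. *)
Lemma chu_vandermonde c p q :
  \sum_(k < p.+1) ('C(p, k) * q ^_ k)%:R * pochhammer (c + k%:R) (p - k)
  = pochhammer (c + q%:R) p.
Proof.
elim: p c => [|p IH] c; first by rewrite big_ord1 bin0 ffactn0 !pochhammer0 mulr1.
rewrite pochhammerSl -addrAC -IH mulr_sumr.
transitivity (\sum_(k < p.+1) ('C(p, k) * q ^_ k)%:R * pochhammer (c + k%:R) (p.+1 - k)
   + \sum_(k < p.+1) ('C(p, k) * q ^_ k.+1)%:R * pochhammer (c + k.+1%:R) (p - k)).
  rewrite big_ord_recl /= [in RHS]big_ord_recl -addrA; congr (_ + _).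
    by rewrite !bin0.
  under eq_bigr => k _.
    rewrite /bump leq0n add1n subSS binS mulnDl natrD mulrDl; over.
  rewrite big_split /=; congr (_ + _).
  rewrite big_ord_recr /= bin_small // mul0n mul0r addr0.
  by apply: eq_bigr => k _; rewrite /bump leq0n add1n subSS.
rewrite -big_split; apply: eq_bigr => k _ /=.
have kp : (k <= p)%N by rewrite -ltnS.
rewrite subSn // pochhammerSl -natr1 addrA (addrAC c 1).
rewrite ffactnSr; case: (leqP k q) => kq.
  by rewrite !natrM natrB //; ring.
by rewrite ffact_small // !muln0 !mul0r mulr0 addr0.
Qed.

End Pochhammer.

(** * Bernstein expansions and positivity of beta means *)

Lemma bin_trinomial N k m : (m <= k <= N)%N ->
  ('C(k, m) * 'C(N, k) = 'C(N, m) * 'C(N - m, k - m))%N.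
Proof.
move=> /andP[mk kN].
apply/eqP; rewrite -(eqn_pmul2r (fact_gt0 m)) -(eqn_pmul2r (fact_gt0 (k - m))).
rewrite -(eqn_pmul2r (fact_gt0 (N - k))); apply/eqP.
transitivity N`!.
  by rewrite -(bin_fact kN) -(bin_fact mk); nia.
rewrite -(bin_fact (leq_trans mk kN)) -(@bin_fact (N - m) (k - m)) ?leq_sub2r //.
have -> : (N - m - (k - m) = N - k)%N by lia.
by nia.
Qed.

(** Expand ['X^m * (1 - 'X + 'X) ^+ (N - m)] and reindex by [k = m + i]; [bin_trinomial] rewrites
    the coefficients, and the terms with [k < m] are zero. *)
Lemma bernstein_Xn (R : realType) N m : (m <= N)%N ->
  'X^m = \sum_(k < N.+1) ('C(k, m)%:R / 'C(N, m)%:R) *: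
            ('C(N, k)%:R *: ('X^k * (1 - 'X) ^+ (N - k))) :> {poly R}.
Proof.
move=> mN.
have C0 : 'C(N, m)%:R != 0 :> R by rewrite pnatr_eq0 -lt0n bin_gt0.
rewrite -(big_mkord xpredT (fun k => ('C(k, m)%:R / 'C(N, m)%:R) *:
            ('C(N, k)%:R *: ('X^k * (1 - 'X) ^+ (N - k))) : {poly R})) /=.
rewrite (@big_cat_nat _ _ _ m) //=; last exact: leq_trans mN _.
rewrite big_nat_cond big1 ?add0r; last first.
  by move=> i /andP[/andP[_ im] _]; rewrite bin_small // mul0r scale0r.
rewrite -[X in index_iota X _]add0n big_addn big_mkord subSn //.
transitivity (\sum_(i < (N - m).+1)
    ('X^(m + i) * (1 - 'X) ^+ (N - m - i)) *+ 'C(N - m, i) : {poly R}).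
  transitivity ('X^m * (1 - 'X + 'X) ^+ (N - m) : {poly R}).
    by rewrite subrK expr1n mulr1.
  rewrite exprDn mulr_sumr; apply: eq_bigr => i _.
  by rewrite mulrnAr exprD mulrAC mulrA.
apply: eq_bigr => i _; rewrite scalerA -subnDA (addnC m) -scaler_nat; congr (_ *: _).
have iN : (i + m <= N)%N by have := ltn_ord i; lia.
rewrite mulrAC -natrM bin_trinomial ?leq_addl //.
by rewrite addnK natrM mulrAC mulfV ?mul1r.
Qed.

(** The ratio is the product of [(k - i) / (N - i)] over [i < m]. Each factor lies in [[0, 1]]
    within [i / N] of [k / N], so the errors add up to at most [m ^ 2 / N]. *)
Lemma bin_ratio_approx (R : realType) N k m : (k <= N)%N -> (m <= N)%N -> (0 < N)%N ->
  `|'C(k, m)%:R / 'C(N, m)%:R - (k%:R / N%:R) ^+ m| <= (m ^ 2)%:R / N%:R :> R.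
Proof.
move=> kN mN N0; have N0' : 0 < N%:R :> R by rewrite ltr0n.
have b01 : 0 <= (k%:R / N%:R : R) <= 1.
  by rewrite divr_ge0 // ler_pdivrMr // mul1r ler_nat.
elim: m mN => [|m IH] mN.
  by rewrite !bin0 expr0 divr1 subrr normr0 mul0r.
have mN' : 0 < (N - m)%:R :> R by rewrite ltr0n subn_gt0.
have C0 : 'C(N, m)%:R != 0 :> R by rewrite pnatr_eq0 -lt0n bin_gt0 ltnW.
have -> : 'C(k, m.+1)%:R / 'C(N, m.+1)%:R =
   'C(k, m)%:R / 'C(N, m)%:R * ((k - m)%:R / (N - m)%:R) :> R.
  have m0 : m.+1%:R != 0 :> R by rewrite pnatr_eq0.
  have e q : 'C(q, m.+1)%:R = (q - m)%:R * 'C(q, m)%:R / m.+1%:R :> R.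
    by rewrite -natrM -mul_bin_left natrM mulrAC mulfV ?mul1r.
  rewrite !e; field.
  by rewrite C0 (gt_eqF mN') ?natr1 ?nat1r ?m0.
set u := _ / _; set a := _ / (N - m)%:R; set c := k%:R / N%:R.
have a01 : 0 <= a <= 1.
  by rewrite divr_ge0 // ler_pdivrMr // mul1r ler_nat leq_sub2r.
have ac : `|a - c| <= m%:R / N%:R.
  rewrite /a /c; case: (leqP m k) => mk; last first.
    have -> : (k - m = 0)%N by lia.
    rewrite mul0r sub0r normrN ger0_norm ?divr_ge0 //.
    by rewrite ler_pM2r ?invr_gt0 // ler_nat ltnW.
  rewrite !natrB ?(ltnW mN) //.
  have h : 0 < N%:R - m%:R :> R by rewrite -natrB // ltnW.
  have -> : (k%:R - m%:R) / (N%:R - m%:R) - k%:R / N%:R =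
     - ((m%:R / N%:R) * ((N%:R - k%:R) / (N%:R - m%:R))) :> R.
    by field; rewrite !gt_eqF.
  rewrite normrN ger0_norm; last first.
    by rewrite !mulr_ge0 ?invr_ge0 ?ler0n ?(ltW h) // subr_ge0 ler_nat.
  rewrite -[leRHS]mulr1 ler_wpM2l ?divr_ge0 //.
  by rewrite ler_pdivrMr // mul1r lerD2l lerN2 ler_nat.
have -> : u * a - c ^+ m.+1 = (u - c ^+ m) * a + c ^+ m * (a - c) by rewrite exprS; ring.
have hc : `|c ^+ m| <= 1.
  by rewrite normrX exprn_ile1 // ger0_norm; case/andP: b01.
have ha : `|a| <= 1 by rewrite ger0_norm; case/andP: a01.
have := IH (ltnW mN); rewrite -/u -/c.
clearbody u a c => h1; apply: le_trans (ler_normD _ _) _; rewrite !normrM.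
apply: (@le_trans _ _ ((m ^ 2)%:R / N%:R * 1 + 1 * (m%:R / N%:R))).
  by apply: lerD; apply: ler_pM.
rewrite mulr1 mul1r -mulrDl ler_pM2r ?invr_gt0 // -natrD ler_nat.
by nia.
Qed.

(* The mean of the beta law of parameters [a] and [b], defined by its moments;
   a point mass when [a] or [b] is [0]. *)
Definition beta_mean (R : realType) (a b : R) : {poly R} -> R^o :=
  poly_lin (fun m => (pochhammer a m / pochhammer (a + b) m : R^o)).

HB.instance Definition _ (R : realType) (a b : R) :=
  GRing.Linear.on (beta_mean a b).
Arguments beta_mean : simpl never.

Section BetaMean.
Variables (R : realType) (a b : R).
Hypothesis ab0 : 0 < a + b.

Lemma beta_meanXn m : beta_mean a b 'X^m = pochhammer a m / pochhammer (a + b) m.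
Proof. exact: poly_linXn. Qed.

(** The beta integral, obtained from the moments alone by writing one factor [1 - 'X] as a
    difference. For nonnegative parameters it gives positivity on the Bernstein basis. *)
Lemma beta_mean_monomial k j : beta_mean a b ('X^k * (1 - 'X) ^+ j) =
  pochhammer a k * pochhammer b j / pochhammer (a + b) (k + j).
Proof.
elim: j k => [|j IH] k.
  by rewrite expr0 mulr1 beta_meanXn addn0 pochhammer0 mulr1.
have -> : 'X^k * (1 - 'X) ^+ j.+1 =
    'X^k * (1 - 'X) ^+ j - 'X^(k.+1) * (1 - 'X) ^+ j :> {poly R}.
  by rewrite !exprS; ring.
rewrite linearB /= !IH addnS addSn !pochhammerS.
have h : pochhammer (a + b) (k + j) != 0 by rewrite pochhammer_neq0.
have h2 : a + b + (k + j)%:R != 0 by rewrite gt_eqF // ltr_wpDr.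
rewrite natrD in h2 *; field.
by rewrite h h2.
Qed.

(* Each power of ['X] is expanded in the Bernstein basis of degree [N], whose
   coefficients converge to the values at [k / N]; the functional is
   nonnegative on the basis. *)
Lemma beta_mean_ge0 (f : {poly R}) : 0 <= a -> 0 <= b ->
  (forall x, 0 <= x <= 1 -> 0 <= f.[x]) -> 0 <= beta_mean a b f.
Proof.
move=> a0 b0 f0.
pose S : R := \sum_(m < size f) `|f`_m| * (m ^ 2)%:R.
have S0 : 0 <= S by apply: sumr_ge0 => m _; rewrite mulr_ge0.
(* [S] does not depend on [N], so a negative mean would violate this bound as soon as
   [N > S / - beta_mean a b f]. *)
suff H N : (size f <= N)%N -> (0 < N)%N -> - S <= N%:R * beta_mean a b f.
  rewrite leNgt; apply/negP => E0.
  pose N := (maxn (size f) (Num.truncn (S / - beta_mean a b f)).+1).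
  have := H N; rewrite leq_maxl => /(_ isT).
  rewrite (leq_trans _ (leq_maxr _ _)) // => /(_ isT).
  rewrite leNgt -ltrN2 opprK -mulrN -ltr_pdivrMr ?oppr_gt0 //.
  rewrite (lt_le_trans (truncnS_gt _)) //.
  by rewrite ler_nat leq_maxr.
move=> fN N0.
have N0' : 0 < N%:R :> R by rewrite ltr0n.
pose B k : {poly R} := 'C(N, k)%:R *: ('X^k * (1 - 'X) ^+ (N - k)).
have B0 k : 0 <= beta_mean a b (B k).
  rewrite linearZ /= beta_mean_monomial mulr_ge0 // divr_ge0 ?mulr_ge0 //.
  - exact: pochhammer_ge0.
  - exact: pochhammer_ge0.
  - by rewrite ltW // pochhammer_gt0.
have B1 : \sum_(k < N.+1) beta_mean a b (B k) = 1.
  transitivity (beta_mean a b 1).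
    rewrite -[1]/('X^0) (@bernstein_Xn R N 0) // linear_sum.
    by apply: eq_bigr => k _; rewrite !bin0 divr1 scale1r.
  by rewrite -[1]/('X^0) beta_meanXn !pochhammer0 divr1.
pose c k := \sum_(m < size f) f`_m * ('C(k, m)%:R / 'C(N, m)%:R).
have cf k : (k <= N)%N -> - (S / N%:R) <= c k.
  move=> kN.
  have x01 : 0 <= (k%:R / N%:R : R) <= 1.
    by rewrite divr_ge0 // ler_pdivrMr // mul1r ler_nat.
  rewrite lerNl -[- c k]addr0; apply: (@le_trans _ _ (- c k + f.[k%:R / N%:R])).
    by rewrite lerD2l f0.
  rewrite horner_coef addrC -sumrB; apply: le_trans (ler_norm _) _.
  apply: le_trans (ler_norm_sum _ _ _) _.
  rewrite /S mulr_suml; apply: ler_sum => m _.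
  rewrite -mulrBr normrM -mulrA ler_wpM2l // distrC bin_ratio_approx //.
  by rewrite ltnW // (leq_trans (ltn_ord m)).
have -> : beta_mean a b f = \sum_(k < N.+1) c k * beta_mean a b (B k).
  rewrite -[f in LHS]coefK poly_def linear_sum /=.
  under eq_bigr => m _.
    rewrite linearZ /= (@bernstein_Xn R N m); last first.
      by rewrite ltnW // (leq_trans (ltn_ord m)).
    rewrite (linear_sum (beta_mean a b)) scaler_sumr; over.
  rewrite exchange_big /=; apply: eq_bigr => k _.
  by rewrite mulr_suml; apply: eq_bigr => m _; rewrite linearZ /= -mulrA.
rewrite -ler_pdivrMl // mulrC mulNr -[leLHS]mulr1 -[X in _ * X <= _]B1 mulr_sumr.
apply: ler_sum => k _; rewrite ler_wpM2r //; apply: cf.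
by rewrite -ltnS.
Qed.

End BetaMean.

(** * The Jacobi operator and its polynomial eigenfunctions *)

(* The Jacobi operator for the exponents [(0, b)] in the variable
   [X = (1 + x) / 2]. *)
Definition jacobi_op (R : realType) (b : R) (p : {poly R}) : {poly R} :=
  'X * (1 - 'X) * p^`()^`() + ((b + 1)%:P - (b + 2)%:P * 'X) * p^`().

Lemma jacobi_op_is_linear (R : realType) (b : R) : linear (jacobi_op b).
Proof.
move=> a p q; rewrite /jacobi_op !derivD !derivZ -!mul_polyC; ring.
Qed.

HB.instance Definition _ (R : realType) (b : R) :=
  GRing.isLinear.Build R {poly R} {poly R} *:%R (jacobi_op b)
    (jacobi_op_is_linear b).

Section JacobiOp.
Variables (R : realType) (b : R).
Local Notation L := (jacobi_op b).

Lemma jacobi_opM (f g : {poly R}) :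
  L (f * g) = L f * g + f * L g + 2 * ('X * (1 - 'X)) * f^`() * g^`().
Proof. rewrite /jacobi_op !derivM !derivD !derivM; ring. Qed.

Lemma mulX_derivXn q : 'X * ('X^q)^`() = q%:R * 'X^q :> {poly R}.
Proof.
rewrite derivXn; case: q => [|q]; first by rewrite mulr0n mulr0 mul0r.
by rewrite mulrnAr -exprS mulr_natl.
Qed.

Lemma deriv_oneBX p :
  ((1 - 'X) ^+ p)^`() = - (p%:R * (1 - 'X) ^+ p.-1) :> {poly R}.
Proof.
rewrite deriv_exp derivB derivX -polyC1 derivC sub0r mulN1r mulNrn.
by rewrite mulr_natl.
Qed.

Lemma mul_deriv_oneBX p :
  (1 - 'X) * ((1 - 'X) ^+ p)^`() = - (p%:R * (1 - 'X) ^+ p) :> {poly R}.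
Proof.
rewrite deriv_oneBX; case: p => [|p]; first by rewrite !mul0r oppr0 mulr0.
by rewrite /= exprS; ring.
Qed.

Lemma jacobi_opXn q : L 'X^q =
  (q%:R * (q%:R + b)) *: 'X^(q.-1) - (q%:R * (q%:R + b + 1)) *: 'X^q.
Proof.
rewrite -!mul_polyC /jacobi_op; case: q => [|[|q]].
- by rewrite expr0 -polyC1 !derivC; ring.
- by rewrite expr1 derivX -polyC1 !derivC /= expr0; ring.
- rewrite !derivXn /= derivMn !derivXn /= !exprS.
  ring.
Qed.

Lemma jacobi_op_oneBX p : L ((1 - 'X) ^+ p) =
  (p%:R ^+ 2) *: (1 - 'X) ^+ p.-1 - (p%:R * (p%:R + b + 1)) *: (1 - 'X) ^+ p.
Proof.
rewrite -!mul_polyC /jacobi_op deriv_oneBX; case: p => [|[|p]].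
- by rewrite mul0r oppr0 linear0; ring.
- by rewrite /= expr0 mulr1 derivN -polyC1 !derivC /=; ring.
- rewrite /= derivN mulr_natl derivMn deriv_oneBX /= !exprS.
  ring.
Qed.

Lemma jacobi_op_monomial q p : L ('X^q * (1 - 'X) ^+ p) =
  (q%:R * (q%:R + b)) *: ('X^(q.-1) * (1 - 'X) ^+ p)
  + (p%:R ^+ 2) *: ('X^q * (1 - 'X) ^+ p.-1)
  - ((q + p)%:R * ((q + p)%:R + b + 1)) *: ('X^q * (1 - 'X) ^+ p).
Proof.
rewrite jacobi_opM jacobi_opXn jacobi_op_oneBX.
have -> : 2 * ('X * (1 - 'X)) * ('X^q)^`() * ((1 - 'X) ^+ p)^`() =
   2 * ('X * ('X^q)^`()) * ((1 - 'X) * ((1 - 'X) ^+ p)^`()) :> {poly R} by ring.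
rewrite mulX_derivXn mul_deriv_oneBX -!mul_polyC natrD; ring.
Qed.

(* In the basis [('X - 1) ^+ k] the eigenvalue equation is a two-term
   recurrence whose leading factor [(k + 1) ^ 2] never vanishes. *)
Lemma jacobi_op_eigen0 (lam : R) (g : {poly R}) :
  L g = lam *: g -> g.[1] = 0 -> g = 0.
Proof.
move=> hL h1.
pose h := g \Po ('X + 1%:P).
have dS (f : {poly R}) : (f \Po ('X + 1%:P))^`() = f^`() \Po ('X + 1%:P).
  by rewrite deriv_comp derivD derivX derivC addr0 mulr1.
have eh : - (h^`()^`() * 'X * 'X) - h^`()^`() * 'X - h^`() - (b + 2) *: (h^`() * 'X)
    = lam *: h.
  rewrite /h !dS -comp_polyZ -hL /jacobi_op -mul_polyC.
  rewrite -[X in X - 'X]polyC1 comp_polyD !comp_polyM !comp_polyB comp_polyM.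
  by rewrite !comp_polyC comp_polyX; ring.
have h0 k : h`_k = 0.
  elim: k => [|k IH].
    by rewrite -horner_coef0 /h horner_comp !hornerE.
  have := congr1 (fun p : {poly R} => p`_k) eh.
  rewrite !(coefB, coefN, coefZ) !coefMX !coef_deriv IH mulr0.
  case: k IH => [|[|k]] IH /=; rewrite ?coef_deriv ?IH.
  - rewrite !(mulr0, subr0, oppr0, sub0r) mulr1n => /eqP.
    by rewrite oppr_eq0 => /eqP.
  - rewrite !(mul0rn, mul0r, mulr0, subr0, oppr0, sub0r) => e; lra.
  - rewrite !mul0rn !(mulr0, subr0, oppr0, sub0r) => /eqP.
    rewrite -opprD oppr_eq0 -mulrnA -mulrnDr mulrn_eq0 /= => /eqP //.
have h00 : h = 0 by apply/polyP => k; rewrite h0 coef0.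
have -> : g = h \Po ('X - 1%:P).
  by rewrite /h -comp_polyA comp_polyD comp_polyX comp_polyC subrK comp_polyXr.
by rewrite h00 comp_poly0.
Qed.

(** [jacobi 0 b n] in the variable [X = (1 + x) / 2], where [(x - 1) / 2 = X - 1]. *)
Definition jacobi01 (n : nat) : {poly R} :=
  \sum_(k < n.+1) jacobi_coef 0 b n k *: ('X - 1%:P) ^+ k.

Lemma horner_jacobi n x : (jacobi 0 b n).[x] = (jacobi01 n).[(1 + x) / 2].
Proof.
rewrite /jacobi /jacobi01 !horner_sum; apply: eq_bigr => k _.
by rewrite !hornerE; congr (_ * _ ^+ _); field.
Qed.

Lemma jacobi01_at1 n : (jacobi01 n).[1] = 1.
Proof.
have := horner_jacobi n 1; rewrite jacobi_at1 add0r pochhammer1.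
have -> : (1 + 1) / 2 = 1 :> R by field.
by rewrite divff // pnatr_eq0 -lt0n fact_gt0.
Qed.

(** With first exponent [0] the coefficient collapses to [(n + b + 1)_j n! / (j!^2 (n - j)!)], whose
    consecutive ratio is rational. This is the recurrence that the eigenvalue equation requires. *)
Lemma jacobi_coefS n k : (k < n)%N ->
  (k%:R + 1) ^+ 2 * jacobi_coef 0 b n k.+1 =
  (n%:R - k%:R) * (n%:R + k%:R + b + 1) * jacobi_coef 0 b n k.
Proof.
move=> kn.
have E j : (j <= n)%N -> jacobi_coef 0 b n j =
    pochhammer (n%:R + b + 1) j * n`!%:R / (j`!%:R ^+ 2 * (n - j)`!%:R).
  move=> jn; rewrite /jacobi_coef addr0 add0r.
  have h : j`!%:R != 0 :> R by rewrite pnatr_eq0 -lt0n fact_gt0.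
  have h' : (n - j)`!%:R != 0 :> R by rewrite pnatr_eq0 -lt0n fact_gt0.
  have := pochhammer_nat R j (n - j); rewrite subnKC // => <-.
  by field; rewrite h h'.
rewrite !E // ?(ltnW kn) // pochhammerS factS natrM.
have -> : (n - k = (n - k.+1).+1)%N by lia.
have h : k`!%:R != 0 :> R by rewrite pnatr_eq0 -lt0n fact_gt0.
have h' : (n - k.+1)`!%:R != 0 :> R by rewrite pnatr_eq0 -lt0n fact_gt0.
have h2 : (k%:R + 1) != 0 :> R by rewrite natr1 pnatr_eq0.
have h3 : n%:R - k%:R != 0 :> R by rewrite subr_eq0 eqr_nat gtn_eqF.
rewrite factS natrM -natr1 [(n - k.+1).+1%:R]( _ : _ = n%:R - k%:R); last first.
  by rewrite -natrB ?(ltnW kn) //; congr (_%:R); lia.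
by field; rewrite h h' h2 h3.
Qed.

(** On powers of [1 - 'X] the operator lowers the degree by at most one. After shifting the lowered
    sum by one, the coefficients below degree [n] agree by [jacobi_coefS], and the top one carries
    the eigenvalue. *)
Lemma jacobi_op_jacobi01 n :
  L (jacobi01 n) = (- (n%:R * (n%:R + b + 1))) *: jacobi01 n.
Proof.
have E : jacobi01 n =
    \sum_(k < n.+1) ((-1) ^+ k * jacobi_coef 0 b n k) *: (1 - 'X) ^+ k.
  apply: eq_bigr => k _.
  have -> : 'X - 1%:P = - 1 *: (1 - 'X) :> {poly R} by rewrite scaleN1r opprB polyC1.
  by rewrite exprZn scalerA mulrC.
rewrite E linear_sum scaler_sumr /=.
under eq_bigr do rewrite linearZ /= jacobi_op_oneBX scalerBr scalerA.
rewrite sumrB big_ord_recl /= expr0n mulr0 scale0r add0r.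
rewrite [X in _ - X]big_ord_recr [RHS]big_ord_recr /= opprD addrA -sumrB.
congr (_ + _); last first.
  by rewrite scalerA -scaleNr scalerA; congr (_ *: _); ring.
apply: eq_bigr => k _.
rewrite /bump leq0n add1n /= !scalerA -scalerBl; congr (_ *: _).
transitivity (- (-1) ^+ k * ((k%:R + 1) ^+ 2 * jacobi_coef 0 b n k.+1) -
   (-1) ^+ k * jacobi_coef 0 b n k * (k%:R * (k%:R + b + 1))).
  by rewrite exprS -natr1; ring.
by rewrite jacobi_coefS //; ring.
Qed.

End JacobiOp.

(** * Generalized translation and the product formula *)

(* [translate_monomial b u m] is the generalized translate by [u] of ['X^m]
   and [translate] its linear extension; both are in the variable
   [T = (1 + t) / 2], with [u = (1 + x) / 2]. *)
Definition translate_coef (R : realType) (b : R) (m p : nat) : R :=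
  'C(m, p)%:R * pochhammer (b + 1 + (m - p)%:R) p / p`!%:R.

Definition translate_monomial (R : realType) (b u : R) (m : nat) : {poly R} :=
  \sum_(p < m.+1) (translate_coef b m p * (u ^+ (m - p) * (1 - u) ^+ p)) *:
    ('X^(m - p) * (1 - 'X) ^+ p).

Definition translate (R : realType) (b u : R) : {poly R} -> {poly R} :=
  poly_lin (translate_monomial b u).

HB.instance Definition _ (R : realType) (b u : R) :=
  GRing.Linear.on (translate b u).
Arguments translate : simpl never.

Section Translate.
Variables (R : realType) (b u : R).

Lemma translate_coefMl m p : (p <= m)%N ->
  translate_coef b m.+1 p * ((m.+1 - p)%:R * ((m.+1 - p)%:R + b)) =
  m.+1%:R * (m.+1%:R + b) * translate_coef b m p.
Proof.
move=> pm; have p0 : p`!%:R != 0 :> R by rewrite pnatr_eq0 -lt0n fact_gt0.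
have hC : (m.+1 - p)%:R * 'C(m.+1, p)%:R = m.+1%:R * 'C(m, p)%:R :> R.
  by rewrite -!natrM -mul_bin_down.
rewrite /translate_coef.
have hP : pochhammer (b + 1 + (m.+1 - p)%:R) p * ((m.+1 - p)%:R + b) =
    pochhammer (b + 1 + (m - p)%:R) p * (m.+1%:R + b).
  have -> : b + 1 + (m.+1 - p)%:R = b + 1 + (m - p)%:R + 1.
    by rewrite subSn // -natr1 addrA.
  have e1 : (m.+1 - p)%:R + b = b + 1 + (m - p)%:R.
    by rewrite subSn // -natr1; ring.
  have e2 : m.+1%:R + b = b + 1 + (m - p)%:R + p%:R :> R.
    by rewrite natrB // -natr1; ring.
  by rewrite e1 e2 -pochhammerS pochhammerSl mulrC.
transitivity (((m.+1 - p)%:R * 'C(m.+1, p)%:R) *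
   (pochhammer (b + 1 + (m.+1 - p)%:R) p * ((m.+1 - p)%:R + b)) / p`!%:R).
  by field.
by rewrite hC hP; field.
Qed.

Lemma translate_coefMr m p : (p <= m)%N ->
  translate_coef b m.+1 p.+1 * p.+1%:R ^+ 2 =
  m.+1%:R * (m.+1%:R + b) * translate_coef b m p.
Proof.
move=> pm; have p0 : p`!%:R != 0 :> R by rewrite pnatr_eq0 -lt0n fact_gt0.
have p1 : p.+1%:R != 0 :> R by rewrite pnatr_eq0.
have hC : p.+1%:R * 'C(m.+1, p.+1)%:R = m.+1%:R * 'C(m, p)%:R :> R.
  by rewrite -!natrM -mul_bin_diag.
rewrite /translate_coef subSS pochhammerS factS natrM.
have -> : b + 1 + (m - p)%:R + p%:R = m.+1%:R + b.
  by rewrite natrB // -natr1; ring.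
transitivity ((p.+1%:R * 'C(m.+1, p.+1)%:R) *
   (pochhammer (b + 1 + (m - p)%:R) p * (m.+1%:R + b)) / p`!%:R).
  by field; rewrite p0 ?natr1 ?nat1r.
by rewrite hC; field.
Qed.

(** The same relation as [jacobi_opXn] with translates in place of powers, which is why translation
    commutes with the operator. *)
Lemma jacobi_op_translate_monomial m :
  jacobi_op b (translate_monomial b u m) =
  (m%:R * (m%:R + b)) *: translate_monomial b u m.-1
  - (m%:R * (m%:R + b + 1)) *: translate_monomial b u m.
Proof.
rewrite [in LHS]/translate_monomial linear_sum /=.
under eq_bigr => p _.
  rewrite linearZ /= jacobi_op_monomial subnK -1?ltnS // scalerBr scalerDr.
  over.
rewrite sumrB big_split /=; congr (_ - _); last first.
  rewrite /translate_monomial scaler_sumr; apply: eq_bigr => p _.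
  by rewrite !scalerA mulrC.
case: m => [|m].
  by rewrite !big_ord1 /= expr0n subnn !(mul0r, scaler0, scale0r, addr0).
(* The two boundary terms vanish: no power of ['X] is left to lower in the first, none of [1 - 'X]
   in the second. *)
rewrite big_ord_recr [X in _ + X]big_ord_recl /= subnn expr0n.
rewrite !(mul0r, scaler0, scale0r, addr0, add0r).
(* Lowering the power of ['X] leaves an extra factor [u], lowering that of [1 - 'X] an extra
   [1 - u]; these weights sum to [1]. *)
transitivity (u *: ((m.+1%:R * (m.+1%:R + b)) *: translate_monomial b u m) +
   (1 - u) *: ((m.+1%:R * (m.+1%:R + b)) *: translate_monomial b u m)); last first.
  by rewrite -scalerDl [u + _]addrC subrK scale1r.
rewrite /translate_monomial !scaler_sumr; congr (_ + _); apply: eq_bigr => p _.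
  have pm : (p <= m)%N by rewrite -ltnS.
  rewrite !scalerA subSn //=; congr (_ *: _).
  rewrite -subSn // mulrAC translate_coefMl // subSn // exprS; ring.
have pm : (p <= m)%N by rewrite -ltnS.
rewrite /bump leq0n add1n /= subSS !scalerA; congr (_ *: _).
by rewrite mulrAC translate_coefMr // exprS; ring.
Qed.

Lemma jacobi_op_translate (f : {poly R}) :
  jacobi_op b (translate b u f) = translate b u (jacobi_op b f).
Proof.
rewrite -[f]coefK poly_def (linear_sum (translate b u)) !(linear_sum (jacobi_op b)).
rewrite (linear_sum (translate b u)); apply: eq_bigr => i _.
rewrite !linearZ /=; congr (_ *: _).
rewrite jacobi_opXn linearB !linearZ /= /translate !poly_linXn.
by rewrite jacobi_op_translate_monomial scalerN.
Qed.

(** At [1] every term with a factor [1 - 'X] vanishes, so only [p = 0] remains. *)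
Lemma translate_at1 (f : {poly R}) : (translate b u f).[1] = f.[u].
Proof.
rewrite /translate /poly_lin horner_sum horner_coef; apply: eq_bigr => m _.
rewrite hornerZ; congr (_ * _).
rewrite /translate_monomial horner_sum big_ord_recl big1 => [|p _].
  rewrite /= subn0 !hornerE /translate_coef bin0 fact0 pochhammer0.
  by rewrite expr1n !(expr0, mulr1, mul1r, divr1) /= invr1 mul1r !mulr1.
by rewrite !hornerE subrr expr0n !mulr0n /= ?mulr0.
Qed.

(** The difference of the two sides is an eigenfunction vanishing at [1], hence zero by
    [jacobi_op_eigen0]. *)
Lemma translate_jacobi01 n :
  translate b u (jacobi01 b n) = (jacobi01 b n).[u] *: jacobi01 b n.
Proof.
apply/eqP; rewrite -subr_eq0; apply/eqP.
apply: (@jacobi_op_eigen0 _ b (- (n%:R * (n%:R + b + 1)))).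
  set l := - (n%:R * _); set q := jacobi01 b n; set c := q.[u].
  have eZ : jacobi_op b (c *: q) = c *: jacobi_op b q by rewrite linearZ.
  have eT : translate b u (l *: q) = l *: translate b u q by rewrite linearZ.
  rewrite (linearB (jacobi_op b)) /= eZ jacobi_op_translate jacobi_op_jacobi01 eT.
  by rewrite scalerBr !scalerA (mulrC c).
by rewrite !hornerE translate_at1 jacobi01_at1 mulr1 subrr.
Qed.

(** The beta law [(b + 1, 1)] is the normalized weight. Its means of the terms of the translate of
    ['X^m] are, up to a common factor, the terms of the binomial expansion of
    [(u + (1 - u)) ^+ m]. *)
Lemma beta_mean_translate (f : {poly R}) : 0 < b + 1 ->
  beta_mean (b + 1) 1 (translate b u f) = beta_mean (b + 1) 1 f.
Proof.
move=> b0; have b2 : 0 < b + 1 + 1 by lra.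
rewrite /translate (poly_lin_comp _ (beta_mean (b + 1) 1)).
rewrite [RHS]/beta_mean /poly_lin; apply: eq_bigr => m _; congr (_ *: _).
rewrite /translate_monomial linear_sum /=.
transitivity (pochhammer (b + 1) m / pochhammer (b + 1 + 1) m * (u + (1 - u)) ^+ m);
  last by rewrite [u + _]addrC subrK expr1n mulr1.
rewrite exprDn mulr_sumr; apply: eq_bigr => p _.
have pm : (p <= m)%N by rewrite -ltnS.
have p0 : p`!%:R != 0 :> R by rewrite pnatr_eq0 -lt0n fact_gt0.
rewrite linearZ /= beta_mean_monomial // pochhammer1 subnK //.
rewrite -[X in pochhammer (b + 1) X / _](subnK pm) pochhammerD /translate_coef.
rewrite -[_ *+ _]mulr_natl /GRing.scale /=; field.
by rewrite p0 pochhammer_neq0.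
Qed.

End Translate.

(** * Binomial identities behind Koornwinder's formula *)

Lemma exprDn_widen (A : comNzRingType) (x y : A) n N : (n <= N)%N ->
  (x + y) ^+ n = \sum_(i < N.+1) (x ^+ (n - i) * y ^+ i) *+ 'C(n, i).
Proof.
move=> nN; rewrite exprDn.
rewrite (big_ord_widen N.+1 (fun i => (x ^+ (n - i) * y ^+ i) *+ 'C(n, i))) //.
rewrite [RHS](bigID (fun i : 'I_N.+1 => (i < n.+1)%N)) /= [X in _ + X]big1 ?addr0 //.
by move=> i; rewrite -leqNgt => hi; rewrite bin_small.
Qed.

Lemma sum_even_double (A : nmodType) (g : nat -> A) n :
  \sum_(i < n.*2 | ~~ odd i) g i = \sum_(k < n) g k.*2.
Proof.
elim: n => [|n IH]; first by rewrite !big_ord0.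
rewrite [RHS]big_ord_recr -IH /= doubleS [LHS]big_mkcond !big_ord_recr /=.
by rewrite odd_double /= addr0 -big_mkcond.
Qed.

Lemma even_part_exprD (F : numFieldType) (s r : F) m :
  ((s + r) ^+ m + (s - r) ^+ m) / 2 =
  \sum_(k < m.+1) 'C(m, k.*2)%:R * (s ^+ (m - k.*2) * r ^+ k.*2).
Proof.
rewrite -(sum_even_double (fun i => 'C(m, i)%:R * (s ^+ (m - i) * r ^+ i))).
(* The range is padded to the even length [m.+1.*2] with vanishing binomials, as [sum_even_double]
   requires. *)
rewrite !(@exprDn_widen _ _ _ m (m.+1.*2).-1) ?doubleS /=; try by lia.
rewrite [RHS]big_mkcond -big_split mulr_suml; apply: eq_bigr => i _ /=.
by rewrite exprNn -signr_odd; case: odd => /=; rewrite ?expr0 ?expr1; field.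
Qed.

(** Both sides equal [m! / ((p - k)! (m - p - k)!)] when [k <= m - p], and vanish otherwise. *)
Lemma koornwinder_bin m p k : (k <= p)%N -> (p <= m)%N ->
  ('C(m, k.*2) * 'C(m - k.*2, p - k) * (k.*2)`! =
   'C(m, p) * ('C(p, k) * (m - p) ^_ k) * k`!)%N.
Proof.
move=> kp pm; case: (leqP k (m - p)) => kq; last first.
  rewrite (ffact_small kq) !muln0 mul0n.
  case: (leqP k.*2 m) => km; last by rewrite bin_small.
  by rewrite [X in (_ * X * _)%N]bin_small ?muln0 //; lia.
have km : (k.*2 <= m)%N by lia.
have pk : (p - k <= m - k.*2)%N by lia.
apply/eqP; rewrite -(eqn_pmul2r (fact_gt0 (p - k))).
rewrite -(eqn_pmul2r (fact_gt0 (m - p - k))); apply/eqP.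
transitivity m`!.
  rewrite -(bin_fact km) -(bin_fact pk).
  have -> : (m - k.*2 - (p - k) = m - p - k)%N by lia.
  by nia.
by rewrite -(bin_fact pm) -(bin_fact kp) -(ffact_fact kq); nia.
Qed.

Lemma triangular_sum (A : nmodType) (g : nat -> nat -> A) m :
  \sum_(k < m.+1) \sum_(l < (m - k).+1) g k (k + l)%N =
  \sum_(p < m.+1) \sum_(k < p.+1) g k p.
Proof.
transitivity (\sum_(k < m.+1) \sum_(p < m.+1 | (k <= p)%N) g k p).
  apply: eq_bigr => k _; have km : (k <= m)%N by rewrite -ltnS.
  rewrite -(big_mkord (fun p => (k <= p)%N) (g k)).
  rewrite (@big_cat_nat _ _ _ k) //=; last by lia.
  rewrite [X in _ = X + _]big_nat_cond [X in _ = X + _]big_pred0 ?add0r; last first.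
    by move=> i; case: (ltnP i k); rewrite ?andbF.
  rewrite -[X in index_iota X _]add0n big_addn subSn // big_mkord.
  by apply: eq_big => [l|l _]; rewrite ?leq_addl // addnC.
rewrite (exchange_big_dep xpredT) //=; apply: eq_bigr => p _.
by rewrite (big_ord_widen_cond m.+1 xpredT (fun k => g k p)) //.
Qed.

(** * Koornwinder's formula and positivity of translation *)

Section TranslatePositive.
Variables (R : realType) (b : R).
Hypotheses (hb1 : - (1 / 2) <= b) (hb2 : b <= 0).

Let b1_gt0 : 0 < b + 1. Proof. by move: hb1; lra. Qed.

(* With [A = u t] and [B = (1 - u) (1 - t)], this is the mean over the second
   variable of Koornwinder's formula: the translate of [f] is the mean of
   [f (A + B rho + 2 sqrt (A B rho w))] over the sign of the square root, over
   [w] with the beta law [(1/2, b + 1/2)] and over [rho] with the beta law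
   [(b + 1, - b)]. *)
Definition koornwinder_mean (A B : R) (m : nat) : {poly R} :=
  \sum_(k < m.+1) ('C(m, k.*2)%:R * (4 ^ k)%:R *
      (pochhammer 2^-1 k / pochhammer (b + 1) k)) *:
    ((A%:P + B *: 'X) ^+ (m - k.*2) * ((A * B) *: 'X) ^+ k).

(** Expanding the power of [A + B rho] and collecting the total power [p = k + l] of [B], the law of
    [rho] has moments [(b + 1)_p / p!], and the remaining sum over [k] is Chu-Vandermonde. *)
Lemma beta_mean_koornwinder (A B : R) m :
  beta_mean (b + 1) (- b) (koornwinder_mean A B m) =
  \sum_(p < m.+1) translate_coef b m p * (A ^+ (m - p) * B ^+ p).
Proof.
rewrite /koornwinder_mean (linear_sum (beta_mean (b + 1) (- b))).
pose G k p := 'C(m, k.*2)%:R * (4 ^ k)%:R *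
  (pochhammer 2^-1 k / pochhammer (b + 1) k) *
  (('C(m - k.*2, p - k)%:R * (A ^+ (m - p) * B ^+ p)) *
   (pochhammer (b + 1) p / p`!%:R)).
transitivity (\sum_(k < m.+1) \sum_(l < (m - k).+1) G k (k + l)%N).
  apply: eq_bigr => k _; rewrite linearZ /=.
  case: (leqP k.*2 m) => km; last first.
    rewrite bin_small // !mul0r scale0r big1 // => l _.
    by rewrite /G bin_small // !mul0r.
  rewrite /G -mulr_sumr; congr (_ * _).
  have kl : (m - k.*2 <= m - k)%N by lia.
  (* Padding the expansion up to [m - k] gives the triangular index set of [triangular_sum]. *)
  rewrite (exprDn_widen _ _ kl) mulr_suml (linear_sum (beta_mean (b + 1) (- b))).
  apply: eq_bigr => l _.
  rewrite [(k + l - k)%N]addKn.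
  case: (leqP l (m - k.*2)) => hl; last first.
    by rewrite bin_small // mulr0n mul0r linear0 !mul0r.
  have -> : ((A%:P ^+ (m - k.*2 - l) * (B *: 'X) ^+ l) *+ 'C(m - k.*2, l)) *
      ((A * B) *: 'X) ^+ k =
     ('C(m - k.*2, l)%:R * (A ^+ (m - (k + l)) * B ^+ (k + l))) *: 'X^(k + l).
    rewrite !exprZn -mulr_natl -polyC_exp !exprD -!mul_polyC.
    have -> : (m - (k + l) = m - k.*2 - l + k)%N by lia.
    by rewrite !polyCM !polyC_exp exprD; ring.
  rewrite linearZ /= beta_meanXn; have -> : b + 1 + - b = 1 by ring.
  by rewrite pochhammer1.
rewrite triangular_sum; apply: eq_bigr => p _.
have pm : (p <= m)%N by rewrite -ltnS.
rewrite /translate_coef -chu_vandermonde.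
have p0 : p`!%:R != 0 :> R by rewrite pnatr_eq0 -lt0n fact_gt0.
transitivity ('C(m, p)%:R * (\sum_(k < p.+1) ('C(p, k) * (m - p) ^_ k)%:R *
    pochhammer (b + 1 + k%:R) (p - k)) / p`!%:R * (A ^+ (m - p) * B ^+ p)); last first.
  by ring.
rewrite mulr_sumr !mulr_suml; apply: eq_bigr => k _.
have kp : (k <= p)%N by rewrite -ltnS.
have k0 : k`!%:R != 0 :> R by rewrite pnatr_eq0 -lt0n fact_gt0.
have h0 : pochhammer (b + 1) k != 0 by rewrite pochhammer_neq0.
have := congr1 (fun n => n%:R : R) (koornwinder_bin kp pm).
rewrite /= => e.
have {}e : 'C(m, k.*2)%:R * 'C(m - k.*2, p - k)%:R * ((4 ^ k)%:R * pochhammer 2^-1 k)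
     = 'C(m, p)%:R * ('C(p, k) * (m - p) ^_ k)%:R :> R.
  apply: (mulIf k0); rewrite -[X in _ = X * _]natrM -[RHS]natrM -e !natrM.
  by rewrite -pochhammer_half; ring.
have hP : pochhammer (b + 1) p = pochhammer (b + 1) k * pochhammer (b + 1 + k%:R) (p - k).
  by rewrite -pochhammerD subnKC.
transitivity (('C(m, k.*2)%:R * 'C(m - k.*2, p - k)%:R *
   ((4 ^ k)%:R * pochhammer 2^-1 k)) * pochhammer (b + 1 + k%:R) (p - k) / p`!%:R *
   (A ^+ (m - p) * B ^+ p)).
  by rewrite /G hP; field; rewrite p0 h0.
by rewrite e; ring.
Qed.

Lemma horner_translate_monomial (u t : R) m : (translate_monomial b u m).[t] =
  beta_mean (b + 1) (- b) (koornwinder_mean (u * t) ((1 - u) * (1 - t)) m).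
Proof.
rewrite beta_mean_koornwinder /translate_monomial horner_sum.
by apply: eq_bigr => p _; rewrite !hornerE /= !exprMn; ring.
Qed.

(** For fixed [rho] this is the mean over [w] of [(f(s + q) + f(s - q)) / 2] with
    [q ^ 2 = 4 A B rho w]; the hypotheses on [A] and [B] keep [s + q] and [s - q] in [[0, 1]]. *)
Lemma koornwinder_mean_ge0 (A B rho : R) (f : {poly R}) :
  0 <= A -> 0 <= B -> 4 * (A * B) <= (1 - A - B) ^+ 2 -> A + B <= 1 ->
  (forall x, 0 <= x <= 1 -> 0 <= f.[x]) -> 0 <= rho <= 1 ->
  0 <= (poly_lin (koornwinder_mean A B) f).[rho].
Proof.
move=> A0 B0 AB AB1 f0 /andP[r0 r1].
pose s := A + B * rho.
pose E m : {poly R} := \sum_(k < m.+1) ('C(m, k.*2)%:R * s ^+ (m - k.*2)) *: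
   ((4 * A * B * rho) *: 'X) ^+ k.
have -> : (poly_lin (koornwinder_mean A B) f).[rho] =
    beta_mean 2^-1 (b + 1 / 2) (poly_lin E f).
  rewrite (poly_lin_comp E (beta_mean _ _)) /poly_lin horner_sum.
  apply: eq_bigr => m _; rewrite hornerZ; congr (_ * _).
  rewrite horner_sum /E (linear_sum (beta_mean _ _)); apply: eq_bigr => k _.
  rewrite [in RHS]exprZn scalerA linearZ /= beta_meanXn.
  have -> : 2^-1 + (b + 1 / 2) = b + 1 by field.
  by rewrite !hornerE /= natrX !exprMn /GRing.scale /= /s; ring.
apply: beta_mean_ge0; rewrite ?invr_ge0 //.
- by move: b1_gt0; lra.
- by move: hb1; lra.
move=> w /andP[w0 w1].
pose q := Num.sqrt (4 * A * B * rho * w).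
have q0 : 0 <= q by exact: sqrtr_ge0.
have ABr0 : 0 <= 4 * A * B * rho * w by rewrite !mulr_ge0.
have q2 : q ^+ 2 = 4 * A * B * rho * w by rewrite sqr_sqrtr.
have -> : (poly_lin E f).[w] = (f.[s + q] + f.[s - q]) / 2.
  rewrite /poly_lin horner_sum ![f.[_]]horner_coef -big_split mulr_suml.
  apply: eq_bigr => m _ /=; rewrite -mulrDr -mulrA even_part_exprD hornerZ; congr (_ * _).
  rewrite horner_sum; apply: eq_bigr => k _.
  by rewrite -muln2 mulnC exprM q2 !hornerE.
have s0 : 0 <= s by rewrite addr_ge0 // mulr_ge0.
have sAB : s <= A + B by rewrite lerD2l ler_piMr.
(* Arithmetic-geometric mean: [4 A (B rho) <= (A + B rho) ^ 2]. *)
have qs : q <= s.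
  rewrite -(@ler_pXn2r _ 2) ?nnegrE // q2 /s.
  have h : 4 * A * B * rho * w <= 4 * A * B * rho.
    by rewrite ler_piMr // !mulr_ge0.
  have := sqr_ge0 (A - B * rho); move: h; rewrite !expr2; nra.
have qs1 : q <= 1 - s.
  rewrite -(@ler_pXn2r _ 2) ?nnegrE ?subr_ge0 //; last exact: le_trans AB1.
  rewrite q2; apply: (@le_trans _ _ (4 * (A * B))).
    rewrite (mulrA 4) -(mulrA _ rho) ler_piMr ?mulr_ge0 //; last by rewrite mulr_ile1.
  apply: (le_trans AB); rewrite ler_pXn2r ?nnegrE //; lra.
by rewrite divr_ge0 // addr_ge0 // f0 //; apply/andP; split; lra.
Qed.

Lemma translate_ge0 (u t : R) (f : {poly R}) :
  0 <= u <= 1 -> 0 <= t <= 1 ->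
  (forall x, 0 <= x <= 1 -> 0 <= f.[x]) -> 0 <= (translate b u f).[t].
Proof.
move=> /andP[u0 u1] /andP[t0 t1] f0.
pose A := u * t; pose B := (1 - u) * (1 - t).
have -> : (translate b u f).[t] =
    beta_mean (b + 1) (- b) (poly_lin (koornwinder_mean A B) f).
  rewrite (poly_lin_comp _ (beta_mean _ _)) /translate /poly_lin horner_sum.
  by apply: eq_bigr => m _; rewrite hornerZ horner_translate_monomial.
have A0 : 0 <= A by rewrite mulr_ge0.
have B0 : 0 <= B by rewrite mulr_ge0 // subr_ge0.
have ut : 0 <= u * (1 - t) by rewrite mulr_ge0 // subr_ge0.
have tu : 0 <= t * (1 - u) by rewrite mulr_ge0 // subr_ge0.
apply: beta_mean_ge0 => [|||rho hrho].
- by rewrite addrAC subrr add0r.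
- exact: ltW.
- by rewrite oppr_ge0.
apply: koornwinder_mean_ge0 => //.
(* With [x = u (1 - t)] and [y = t (1 - u)], the condition is [4 x y <= (x + y) ^ 2]. *)
- have -> : 1 - A - B = u * (1 - t) + t * (1 - u) by rewrite /A /B; ring.
  have -> : A * B = (u * (1 - t)) * (t * (1 - u)) by rewrite /A /B; ring.
  have := sqr_ge0 (u * (1 - t) - t * (1 - u)).
  by set x := u * _; set y := t * _; rewrite !expr2; lra.
- by move: ut tu; rewrite /A /B; lra.
Qed.

End TranslatePositive.

(** * Polynomial approximation of an absolute value from above *)

Lemma poly_bound01 (R : realType) (f : {poly R}) :
  exists2 M : R, 0 < M & forall x, 0 <= x <= 1 -> `|f.[x]| <= M.
Proof.
exists (\sum_(i < size f) `|f`_i| + 1).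
  by rewrite ltr_wpDl // sumr_ge0.
move=> x /andP[x0 x1]; rewrite horner_coef ler_wpDr //.
apply: le_trans (ler_norm_sum _ _ _) _; apply: ler_sum => i _.
rewrite normrM normrX -[leRHS]mulr1 ler_wpM2l // exprn_ile1 //.
by rewrite ger0_norm.
Qed.

(* The iteration [u := u + (s ^ 2 - u ^ 2) / 2] increases from [0] to [`|s|] for
   [`|s| <= 1], at a rate uniform in [s]; it is applied to [s = f / M]. *)
Fixpoint abs_poly (R : realType) (f : {poly R}) (k : nat) : {poly R} :=
  if k is k'.+1 then abs_poly f k' + 2^-1 *: (f ^+ 2 - abs_poly f k' ^+ 2) else 0.

(** One step multiplies the gap [s - u] by [(2 - s - u) / 2 <= (2 - s) / 2], and
    [(2 - s) (2 + (k + 1) s) / 2 <= 2 + k s]. So [(s - u) (2 + k s)] never exceeds its initial value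
    [2 s]. *)
Lemma abs_poly_bound (R : realType) (f : {poly R}) (k : nat) (x : R) :
  `|f.[x]| <= 1 ->
  (0 <= (abs_poly f k).[x] <= `|f.[x]|) &&
  ((`|f.[x]| - (abs_poly f k).[x]) * (2 + k%:R * `|f.[x]|) <= 2 * `|f.[x]|).
Proof.
move=> s1; elim: k => [|k IH] /=.
  by rewrite horner0 lexx normr_ge0 /= subr0 mul0r addr0 mulrC.
move: IH; rewrite hornerD hornerZ hornerD hornerN !horner_exp.
rewrite -[f.[x] ^+ 2]real_normK ?num_real //.
move: s1; move: (normr_ge0 f.[x]).
set s := `|f.[x]|; set u := _.[x]; set n := k%:R : R => s0 s1.
have n0 : 0 <= n by exact: ler0n.
rewrite -[k.+1%:R]natr1 -/n => /andP[/andP[u0 us] h].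
have h1 : 0 <= (s - u) * (2 - s - u) by rewrite mulr_ge0 //; lra.
have h2 : 0 <= (s - u) * (s + u) by rewrite mulr_ge0 //; lra.
have -> : s - (u + 2^-1 * (s ^+ 2 - u ^+ 2)) = (s - u) * (2 - s - u) / 2 by field.
rewrite -andbA; apply/and3P; split.
- by rewrite addr_ge0 // mulr_ge0 //; move: h2; rewrite !expr2; lra.
- by move: h1; rewrite !expr2; lra.
apply: le_trans h.
have -> : (s - u) * (2 - s - u) / 2 * (2 + (n + 1) * s) =
   (s - u) * ((2 - s - u) * (2 + (n + 1) * s) / 2) by ring.
apply: ler_wpM2l; first lra.
apply: (@le_trans _ _ ((2 - s) * (2 + (n + 1) * s) / 2)).
  rewrite ler_pM2r ?invr_gt0 //; apply: ler_wpM2r; last by lra.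
  by rewrite addr_ge0 // mulr_ge0 // addr_ge0.
have : 0 <= (n + 1) * s * s by rewrite !mulr_ge0 // addr_ge0.
by lra.
Qed.

Lemma abs_poly_approx (R : realType) (f : {poly R}) (e : R) : 0 < e ->
  exists g : {poly R}, forall x, 0 <= x <= 1 ->
    `|f.[x]| <= g.[x] <= `|f.[x]| + e.
Proof.
move=> e0; have [M M0 fM] := poly_bound01 f.
have [k k0 ke] : exists2 k : nat, 0 < k%:R :> R & 2 * M / k%:R <= e.
  exists (Num.truncn (e^-1 * (2 * M))).+1; first by rewrite ltr0n.
  by rewrite ler_pdivrMr ?ltr0n // -ler_pdivrMl //; apply/ltW/truncnS_gt.
(* The iterates stay below the absolute value by at most [2 M / k]; adding this constant moves them
   above it. *)
exists (M *: abs_poly (M^-1 *: f) k + (2 * M / k%:R)%:P) => x x01.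
have Mi0 : 0 <= M^-1 by rewrite invr_ge0 ltW.
have s1 : `|(M^-1 *: f).[x]| <= 1.
  by rewrite hornerZ normrM [`|M^-1|]ger0_norm // ler_pdivrMl // mulr1 fM.
have := abs_poly_bound k s1.
have eM : `|f.[x]| = M * `|(M^-1 *: f).[x]|.
  by rewrite hornerZ normrM [`|M^-1|]ger0_norm // mulVKf ?gt_eqF.
rewrite !hornerD [(M *: _).[x]]hornerZ hornerC eM.
move: s1; move: (normr_ge0 (M^-1 *: f).[x]).
set s := `|_|; set u := _.[x] => s0 s1 /andP[/andP[u0 us] h].
have d : s - u <= 2 / k%:R.
  rewrite ler_pdivlMr //; case: (eqVneq s 0) => [s00|sn0].
    have -> : u = 0 by lra.
    by rewrite s00 subrr mul0r.
  have sp : 0 < s by rewrite lt_neqAle eq_sym sn0.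
  rewrite -(ler_pM2r sp); apply: le_trans h.
  by rewrite -mulrA ler_wpM2l ?subr_ge0 // lerDr.
have := ler_wpM2l (ltW M0) d; have := ler_wpM2l (ltW M0) us.
rewrite mulrBr mulrA (mulrC M 2) => h1 h2.
by apply/andP; split; lra.
Qed.

(** * Integrals of polynomials against the Jacobi weight *)

Section WeightIntegral.
Variable R : realType.
Local Notation mu := (@lebesgue_measure R).

Lemma is_derive_powR1D (e t : R) : -1 < t ->
  is_derive t 1 (fun x : R => (1 + x) `^ e) (e * (1 + t) `^ (e - 1)).
Proof.
move=> t1; have t0 : 0 < 1 + t by lra.
have h := is_derive1_powR e t0.
have h1 : is_derive t (1 : R) (fun x : R => 1 + x) 1.
  by have := is_deriveD (is_derive_cst (1 : R) t (1 : R)) (is_derive_id t (1 : R));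
    rewrite add0r.
by have := is_derive1_comp h h1; rewrite mulr1.
Qed.

Lemma measurable_powR1D (e : R) (D : set R) :
  measurable_fun D (fun x : R => (1 + x) `^ e).
Proof.
apply: measurable_funTS; apply: (measurableT_comp (measurable_powR e)).
exact: measurable_funD.
Qed.

Lemma measurable_horner_half1D (g : {poly R}) (D : set R) :
  measurable_fun D (fun x : R => g.[(1 + x) / 2]).
Proof.
apply: measurable_funTS; apply: (@measurableT_comp _ _ _ _ _ _ (horner g)).
  by apply: continuous_measurable_fun; exact: continuous_horner.
apply: (@measurable_funM _ _ _ _ (fun x : R => 1 + x) (cst 2^-1)).
  exact: measurable_funD.
exact: measurable_cst.
Qed.

Lemma measurable_weight_poly (b : R) (g : {poly R}) (D : set R) :
  measurable_fun D (fun t => (g.[(1 + t) / 2] * jacobi_weight b t)%:E).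
Proof.
apply/measurable_EFinP; apply: measurable_funM; last exact: measurable_powR1D.
exact: measurable_horner_half1D.
Qed.

Lemma measurable_weight_monomial (b : R) (m : nat) (D : set R) :
  measurable_fun D (fun t => (((1 + t) / 2) ^+ m * jacobi_weight b t)%:E).
Proof.
have := measurable_weight_poly b 'X^m (D := D).
by congr measurable_fun; apply/funext => t; rewrite hornerXn.
Qed.

Lemma integral_powR1D_cut (e d : R) : 0 < e -> -1 < d -> d < 1 ->
  (\int[mu]_(t in `[d, 1%R]) ((1 + t) `^ (e - 1))%:E =
   (2 `^ e / e - (1 + d) `^ e / e)%:E)%E.
Proof.
move=> e0 d1 d2.
pose F (x : R) := e^-1 * (1 + x) `^ e.
have dF (x : R) : -1 < x -> is_derive x 1 F ((1 + x) `^ (e - 1)).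
  move=> x1; have := is_deriveZ e^-1 (is_derive_powR1D e x1).
  by rewrite /GRing.scale /= mulKf ?gt_eqF.
have cont (x : R) : -1 < x -> {for x, continuous F}.
  move=> x1; apply/differentiable_continuous/derivable1_diffP.
  by have [] := dF x x1.
rewrite (@continuous_FTC2 _ _ F d 1) //.
- by rewrite /F EFinB !(mulrC e^-1).
- apply: derivable_within_continuous => x; rewrite in_itv /= => /andP[dx _].
  have x1 : -1 < x by exact: lt_le_trans dx.
  by have [] := is_derive_powR1D (e - 1) x1.
- split.
  + move=> x; rewrite in_itv /= => /andP[dx _].
    by have [] := dF x (lt_trans d1 dx).
  + by apply: cvg_at_right_filter; exact: cont.
  + by apply: cvg_at_left_filter; apply: cont; lra.
- move=> x; rewrite in_itv /= => /andP[dx _].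
  by rewrite derive1E; have [_ ->] := dF x (lt_trans d1 dx).
Qed.

(** For [e < 1] the integrand is unbounded near [-1], so the fundamental theorem of calculus is
    applied from [-1 + 1 / (n + 1)] on, and monotone convergence gives the limit. *)
Lemma integral_powR1D (e : R) : 0 < e ->
  (\int[mu]_(t in `](-1)%R, 1%R]) ((1 + t) `^ (e - 1))%:E = (2 `^ e / e)%:E)%E.
Proof.
move=> e0; rewrite itv_open_bnd_bigcup.
set A := fun n : nat => _.
have cv : (\int[mu]_(t in A n) ((1 + t) `^ (e - 1))%:E)%E @[n --> \oo] -->
    (\int[mu]_(t in \bigcup_n A n) ((1 + t) `^ (e - 1))%:E)%E.
  apply: ge0_nondecreasing_set_cvg_integral => //.
  - move=> m n mn; apply/subsetPset; apply: subset_itv; rewrite bnd_simp //.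
    by rewrite lerD2l lef_pV2 ?posrE // ler_nat.
  - by move=> n; exact: measurable_itv.
  - by move=> n; apply/measurable_EFinP; exact: measurable_powR1D.
  - by move=> n t _; rewrite lee_fin powR_ge0.
apply: (cvg_unique (@ereal_hausdorff R) cv).
have eqA n : (\int[mu]_(t in A n) ((1 + t) `^ (e - 1))%:E)%E =
    (2 `^ e / e - (n.+1%:R^-1) `^ e / e)%:E.
  have i0 : 0 < n.+1%:R^-1 :> R by rewrite invr_gt0.
  have i1 : n.+1%:R^-1 <= 1 :> R by rewrite invf_le1 // ler1n.
  rewrite integral_powR1D_cut //; first by rewrite addrA subrr add0r.
  - by rewrite ltrDl.
  - by move: i0 i1; set x := _^-1 => i0 i1; lra.
rewrite /=; under eq_fun do rewrite eqA.
apply: cvg_EFin; first by near=> n.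
rewrite -[X in _ --> X]subr0 -[X in _ - X](mul0r e^-1).
apply: cvgB; first exact: cvg_cst.
apply: cvgM; last exact: cvg_cst.
have /cvg_at_rightP := powR_cvg0 e0; apply; split => //.
exact: cvg_harmonic.
Unshelve. all: by end_near. Qed.

Lemma integral_weight_monomial (b : R) (m : nat) : 0 < b + 1 ->
  (\int[mu]_(t in `[(-1)%R, 1%R]) (((1 + t) / 2) ^+ m * jacobi_weight b t)%:E =
   (2 `^ (b + 1) / (b + 1 + m%:R))%:E)%E.
Proof.
move=> b0; have e0 : 0 < b + 1 + m%:R by rewrite ltr_wpDr.
(* Dropping the endpoint makes [1 + t] positive, so the power and the weight merge into one
   exponent. *)
rewrite -integral_itv_obnd_cbnd; last exact: measurable_weight_monomial.
under eq_integral => t.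
  rewrite inE /= in_itv /= => /andP[t1 _].
  have t0 : 0 < 1 + t by lra.
  have -> : ((1 + t) / 2) ^+ m * jacobi_weight b t =
      (2 ^+ m)^-1 * (1 + t) `^ (b + 1 + m%:R - 1).
    rewrite /jacobi_weight expr_div_n; have -> : b + 1 + m%:R - 1 = m%:R + b by ring.
    rewrite powRD; last by rewrite (gt_eqF t0) implybT.
    by rewrite powR_mulrn ?ltW //; ring.
  rewrite EFinM; over.
rewrite ge0_integralZl //; first last.
- by move=> t _; rewrite lee_fin powR_ge0.
- by apply/measurable_EFinP; exact: measurable_powR1D.
rewrite integral_powR1D // -EFinM; congr (_%:E).
rewrite powRD ?pnatr_eq0 ?implybT // powR_mulrn //.
by field; rewrite (gt_eqF e0) expf_neq0 // pnatr_eq0.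
Qed.

Lemma integrable_weight_monomial (b : R) (m : nat) : 0 < b + 1 ->
  mu.-integrable `[-1, 1]
    (fun t => (((1 + t) / 2) ^+ m * jacobi_weight b t)%:E).
Proof.
move=> b0; apply/integrableP; split; first exact: measurable_weight_monomial.
under eq_integral => t.
  rewrite inE /= in_itv /= => /andP[t1 _].
  rewrite /= ger0_norm; last first.
    by rewrite mulr_ge0 ?powR_ge0 // exprn_ge0 // divr_ge0 //; lra.
  over.
by rewrite integral_weight_monomial // ltry.
Qed.

(** Links the formal moments to integration: the [i]-th moment of the beta law [(b + 1, 1)] is
    [(b + 1) / (b + 1 + i)], as for the normalized weight. *)
Lemma integral_weight_poly (b : R) (g : {poly R}) : 0 < b + 1 ->
  (\int[mu]_(t in `[(-1)%R, 1%R]) (g.[(1 + t) / 2] * jacobi_weight b t)%:E =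
   (2 `^ (b + 1) / (b + 1) * beta_mean (b + 1) 1 g)%:E)%E.
Proof.
move=> b0.
under eq_integral => t _.
  rewrite horner_coef mulr_suml -sumEFin.
  under eq_bigr do rewrite -mulrA EFinM.
  over.
have int (i : 'I_(size g)) := integrable_weight_monomial i b0.
rewrite integral_sum //; last by move=> i; exact/integrableZl/int.
rewrite /beta_mean /poly_lin mulr_sumr -sumEFin; apply: eq_bigr => i _.
rewrite integralZl // integral_weight_monomial // -EFinM; congr (_%:E).
have h : pochhammer (b + 1) i != 0 by rewrite pochhammer_neq0.
have e0 : b + 1 + i%:R != 0 by rewrite gt_eqF // ltr_wpDr.
have -> : pochhammer (b + 1 + 1) i = pochhammer (b + 1) i * (b + 1 + i%:R) / (b + 1).
  by rewrite -pochhammerS pochhammerSl mulrAC mulfV ?mul1r // gt_eqF.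
by rewrite /GRing.scale /=; field; rewrite h e0 gt_eqF.
Qed.

End WeightIntegral.

(** * The kernel as a translate and the bound on the Lebesgue function *)

Definition kernel_at1 (R : realType) (b : R) (n : nat) : {poly R} :=
  \sum_(j < n.+1) (jacobi_h b j)^-1 *: jacobi01 b j.

Lemma jacobi_kernelE (R : realType) (b : R) n x t :
  jacobi_kernel b n x t =
  (translate b ((1 + x) / 2) (kernel_at1 b n)).[(1 + t) / 2].
Proof.
rewrite /kernel_at1 (linear_sum (translate _ _)) horner_sum; apply: eq_bigr => j _.
by rewrite linearZ /= translate_jacobi01 !hornerZ !horner_jacobi; ring.
Qed.

Lemma jacobi_kernel_at1 (R : realType) (b : R) n t :
  jacobi_kernel b n 1 t = (kernel_at1 b n).[(1 + t) / 2].
Proof.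
rewrite /jacobi_kernel /kernel_at1 horner_sum; apply: eq_bigr => j _.
rewrite hornerZ !horner_jacobi; have -> : (1 + 1) / 2 = 1 :> R by field.
by rewrite jacobi01_at1 mul1r mulrC.
Qed.

(** Positivity of translation applied to [g + f] and [g - f]. *)
Lemma translate_norm_le (R : realType) (b u t : R) (f g : {poly R}) :
  - (1 / 2) <= b -> b <= 0 -> 0 <= u <= 1 -> 0 <= t <= 1 ->
  (forall x, 0 <= x <= 1 -> `|f.[x]| <= g.[x]) ->
  `|(translate b u f).[t]| <= (translate b u g).[t].
Proof.
move=> hb1 hb2 u01 t01 fg.
rewrite ler_norml -subr_ge0 opprK addrC -hornerD -(linearD (translate b u)).
rewrite -[X in _ && X]subr_ge0 -hornerN -hornerD -(linearB (translate b u)).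
apply/andP; split; apply: translate_ge0 => // x /fg; rewrite ler_norml hornerD ?hornerN.
  by move=> /andP[+ _]; rewrite -subr_ge0 opprK addrC.
by move=> /andP[_]; rewrite -subr_ge0.
Qed.

Lemma lebesgue_fun_le1 (R : realType) (b : R) (n : nat) (x : R) :
  - (1 / 2) <= b -> b <= 0 -> -1 <= x <= 1 ->
  (lebesgue_fun b n x <= lebesgue_fun b n 1)%E.
Proof.
move=> hb1 hb2 /andP[x1 x2]; have b0 : 0 < b + 1 by lra.
apply/lee_addgt0Pr => e e0.
(* [C] is the total mass of the weight: a uniform error [e / C] costs at most [e] after
   integration. *)
pose C := 2 `^ (b + 1) / (b + 1).
have C0 : 0 < C by rewrite divr_gt0 // powR_gt0.
set f := kernel_at1 b n.
have [g fg] := abs_poly_approx f (divr_gt0 e0 C0).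
have half01 (t : R) : `[-1, 1]%classic t -> 0 <= (1 + t) / 2 <= 1.
  by rewrite /= in_itv /= => /andP[h1 h2]; apply/andP; split; lra.
have w0 t : 0 <= jacobi_weight b t by exact: powR_ge0.
have mabs (p : {poly R}) (D : set R) :
    measurable_fun D (fun t : R => (`|p.[(1 + t) / 2]| * jacobi_weight b t)%:E).
  apply/measurable_EFinP; apply: measurable_funM; last exact: measurable_powR1D.
  by apply: measurableT_comp => //; exact: measurable_horner_half1D.
apply: (@le_trans _ _ (\int[@lebesgue_measure R]_(t in `[(-1)%R, 1%R])
    ((translate b ((1 + x) / 2) g).[(1 + t) / 2] * jacobi_weight b t)%:E)%E).
  rewrite /lebesgue_fun; under eq_integral do rewrite jacobi_kernelE.
  apply: ge0_le_integral => //.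
  - by move=> t _; rewrite lee_fin mulr_ge0.
  - exact: mabs.
  - exact: measurable_weight_poly.
  - move=> t /half01 t01; rewrite lee_fin ler_wpM2r //.
    apply: translate_norm_le => //; first by apply/andP; split; lra.
    by move=> y /fg /andP[].
(* The integral of the translate of [g] is that of [g], which removes [x]. *)
rewrite integral_weight_poly // beta_mean_translate // -integral_weight_poly //.
rewrite /lebesgue_fun.
under [X in (_ <= X + _)%E]eq_integral do rewrite jacobi_kernel_at1.
(* Writing [e] as the integral of the constant [e / C] reduces the rest to a pointwise
   inequality. *)
have -> : e%:E = (\int[@lebesgue_measure R]_(t in `[(-1)%R, 1%R])
    (((e / C)%:P).[(1 + t) / 2] * jacobi_weight b t)%:E)%E.
  rewrite integral_weight_poly // -/C -[(e / C)%:P]mulr1 mul_polyC linearZ /=.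
  rewrite -(expr0 'X) beta_meanXn !pochhammer0 divr1 /GRing.scale /= mulr1.
  by congr (_%:E); field; rewrite gt_eqF.
rewrite -ge0_integralD //; last 4 first.
- by move=> t _; rewrite lee_fin mulr_ge0.
- exact: mabs.
- by move=> t _; rewrite lee_fin mulr_ge0 // hornerC divr_ge0 // ltW.
- exact: measurable_weight_poly.
apply: ge0_le_integral => //.
- move=> t /half01 /fg /andP[h _]; rewrite lee_fin mulr_ge0 //.
  exact: le_trans h.
- exact: measurable_weight_poly.
- apply: emeasurable_funD; [exact: mabs|exact: measurable_weight_poly].
- move=> t /half01 /fg /andP[_ h]; rewrite -EFinD lee_fin hornerC -mulrDl.
  exact: ler_wpM2r.
Qed.

Theorem proposition5p3 (R : realType) (b : R) (hb1 : - (1 / 2) <= b)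
    (hb2 : b <= 0) (n : nat) :
  lebesgue_cst b n = lebesgue_fun b n 1 /\
  lebesgue_fun b n 1 = jacobi_ell b n.
Proof.
(* The second equality holds by unfolding; for the first, [x = 1] belongs to the set and dominates
   it. *)
split=> //; apply/eqP; rewrite eq_le; apply/andP; split.
  apply: ge_ereal_sup => _ [x + <-]; rewrite /= in_itv /=.
  exact: lebesgue_fun_le1.
by apply: ereal_sup_ubound; exists 1 => //=; rewrite in_itv /= lexx andbT; lra.
Qed.
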